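(* Let $H$ be a non-zero real constant and let $Y:\Sigma\to\mathbb{I}^3$ be a discrete isothermic constant mean curvature $H$ surface given by Weierstrass data $(h,g)$, with the Gauss map $\nu$ associated to these data. Then $Y^P:\Sigma\to\mathbb{I}^3$ defined by $$Y^P:=Y+\frac1H\,\nu$$ is a parallel (i.e. edge-parallel to $Y$) surface of constant mean curvature $-H$ with Weierstrass data $(h^P,g^P)=(\bar g,\bar h)$.
   Context: Space: $\mathbb{R}^{3,1}$ is Minkowski $4$-space with bilinear form $(\cdot,\cdot)$ of signature $(-+++)$, $\mathcal{L}=\{X:(X,X)=0\}$, $\mathfrak{p}=(1,0,0,1)^t$, $\tilde{\mathfrak{p}}=\frac12(-1,0,0,1)^t$, $P=\{X:(X,\mathfrak{p})=1\}$. Isotropic $3$-space is $\mathbb{I}^3=\{X\in\mathbb{R}^{3,1}:(X,\mathfrak{p})=0\}=\mathbb{R}^2\oplus\langle\mathfrak{p}\rangle$ with $\mathbb{R}^2=\langle\mathfrak{p},\tilde{\mathfrak{p}}\rangle^\perp$; its points $(\mathbf l,\mathbf x,\mathbf y,\mathbf l)^t$ are also written $(\mathbf l,\mathbf x,\mathbf y)$. $\pi_2:\mathbb{R}^{3,1}\to\mathbb{R}^2$ is the orthogonal projection, so $\pi_2(\mathbf l,\mathbf x,\mathbf y)=(\mathbf x,\mathbf y)$, and $\mathbb{R}^2\cong\mathbb{C}$. Domain: $\Sigma\subset\mathbb{Z}^2$ is a discrete simply-connected domain (connected through edges, and every closed edge path can be contracted through elementary quadrilaterals of $\Sigma$). Edges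 join horizontally or vertically adjacent points. An elementary quadrilateral $(ijk\ell)$ is $i=(a,b)$, $j=(a+1,b)$, $k=(a+1,b+1)$, $\ell=(a,b+1)$. For a function $f$ on $\Sigma$: $f_i=f(i)$, $df_{ij}=f_i-f_j$, $f_{ij}=\frac12(f_i+f_j)$. Discrete holomorphic: $x:\Sigma\to\mathbb{C}$ is discrete holomorphic with cross-ratios factorizing function $m$ (determined up to a non-zero real constant factor) if $m$ is a real nowhere-vanishing function on unoriented edges such that on every elementary quadrilateral $m_{ij}=m_{\ell k}$, $m_{i\ell}=m_{jk}$ and $\frac{x_i-x_j}{x_j-x_k}\cdot\frac{x_k-x_\ell}{x_\ell-x_i}=\frac{m_{i\ell}}{m_{ij}}$. Circular net: $X:\Sigma\to\mathbb{I}^3$ such that on each elementary quadrilateral the four points are coplanar and their projections under $\pi_2$ are concircular in $\mathbb{R}^2$ (straight lines counting as degenerate circles). Discrete isothermic surface: a circular net $X$ for which $\pi_2(X)$ is discrete holomorphic. Two nets $X,\tilde X$ are edge-parallel if $dX_{ij}\parallel d\tilde X_{ij}$ on every edge. Lightlike Gauss map of a circular net $X$: $N:\Sigma\to\mathcal{L}\cap P$ with $dN_{ij}$ a real multiple of $dX_{ij}$ on every edge (generically a non-zero multiple). The corresponding Gauss map is $\nu=N-\tilde{\mathfrak{p}}:\Sigma\to\mathbb{I}^3$. Mixed area of edge-parallel nets: $A(X,\tilde X)_{ijk\ell}=\frac14\big((X_i-X_k)\wedge(\tilde X_j-\tilde X_\ell)-(X_j-X_\ell)\wedge(\tilde X_i-\tilde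 X_k)\big)\in\wedge^2\mathbb{R}^{3,1}$. A circular net $X$ with lightlike Gauss map $N$ has constant mean curvature $H$ (is cmc-$H$) if $A(X,N)_{ijk\ell}+H\,A(X,X)_{ijk\ell}=0$ on every elementary quadrilateral. Weierstrass data: for $H\in\mathbb{R}\setminus\{0\}$, a cmc-$H$ surface $Y$ has Weierstrass data $(h,g)$ if $g,h:\Sigma\to\mathbb{C}$ are discrete holomorphic, $g$ has a cross-ratios factorizing function $m$ with $dh_{ij}=\frac{H}{m_{ij}dg_{ij}}$ on every edge, $dY_{ij}=\frac1H\operatorname{Re}\big((\bar h_{ij}+g_{ij},1,-\mathrm{i})\,dh_{ij}\big)$ on every edge, and the lightlike Gauss map of $Y$ is $N=-\frac12(1+|\varphi|^2,2\operatorname{Re}\varphi,-2\operatorname{Im}\varphi,-1+|\varphi|^2)^t$ with $\varphi=\bar h+g$; equivalently $\nu=-\frac12(|\varphi|^2,2\operatorname{Re}\varphi,-2\operatorname{Im}\varphi)$. For $Y^P$ the same definition is used with $H$ replaced by $-H$ and $(h,g)$ by $(h^P,g^P)$ (with a cross-ratios factorizing function of $g^P$). *)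

(* Defs.v *)
From HB Require Import structures.
From mathcomp Require Import all_boot all_order all_algebra.
From mathcomp Require Import reals complex.

Set Implicit Arguments.
Unset Strict Implicit.
Unset Printing Implicit Defensive.

Import Order.TTheory GRing.Theory Num.Theory.
Local Open Scope ring_scope.
Local Open Scope complex_scope.

(* A map defined on S is represented by a total function on Z2; all the
   predicates below only constrain its values at the points of S. *)
Notation Z2 := (int * int)%type.

Section Domain.
Variable S : {pred Z2}.

Definition adjacent (i j : Z2) : bool :=
  ((i.2 == j.2) && (`|i.1 - j.1| == 1)) || ((i.1 == j.1) && (`|i.2 - j.2| == 1)).

Definition edge (i j : Z2) : bool := [&& i \in S, j \in S & adjacent i j].

Definition quad (i j k l : Z2) : bool :=
  [&& i \in S, j \in S, k \in S & l \in S] &&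
  [&& j == (i.1 + 1, i.2), k == (i.1 + 1, i.2 + 1) & l == (i.1, i.2 + 1)].

Definition edge_connected : Prop :=
  forall i j, i \in S -> j \in S -> exists p, path edge i p /\ last i p = j.

Definition quad_rot (a b c d : Z2) : bool :=
  [|| quad a b c d, quad b c d a, quad c d a b | quad d a b c].

(* Homotopy of edge paths, relative to the end points: generated by the removal
   of back-and-forth steps and by sweeping across an elementary quadrilateral. *)
Inductive homotopic : seq Z2 -> seq Z2 -> Prop :=
| homotopic_refl p : homotopic p p
| homotopic_sym p q : homotopic p q -> homotopic q p
| homotopic_trans p q r : homotopic p q -> homotopic q r -> homotopic p r
| homotopic_spur s t a b : edge a b ->
    homotopic (s ++ [:: a, b, a & t]) (s ++ a :: t)
| homotopic_quad s t a b c d : quad_rot a b c d ->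
    homotopic (s ++ [:: a, b, c & t]) (s ++ [:: a, d, c & t]).

Definition simply_connected : Prop :=
  edge_connected /\
  forall i p, i \in S -> path edge i p -> last i p = i ->
    homotopic (i :: p) [:: i].

End Domain.

Section Geometry.
Variable R : realType.

(* Minkowski space R^{3,1} is 'cV[R]_4, with coordinate 0 timelike. *)
Definition vec4 (a b c d : R) : 'cV[R]_4 := \col_(i < 4) [:: a; b; c; d]`_i.

Definition mink (X Y : 'cV[R]_4) : R :=
  - (X 0 0 * Y 0 0) + X 1 0 * Y 1 0 + X 2 0 * Y 2 0 + X 3 0 * Y 3 0.

Definition pvec : 'cV[R]_4 := vec4 1 0 0 1.
Definition ptilde : 'cV[R]_4 := 2^-1 *: vec4 (-1) 0 0 1.

Definition in_cone (X : 'cV[R]_4) : Prop := mink X X = 0.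
Definition in_P (X : 'cV[R]_4) : Prop := mink X pvec = 1.
Definition in_iso3 (X : 'cV[R]_4) : Prop := mink X pvec = 0.

(* The point (l, x, y) of isotropic 3-space. *)
Definition iso_pt (l x y : R) : 'cV[R]_4 := vec4 l x y l.

(* The orthogonal projection along <p, ptilde>, i.e. along the coordinates 0
   and 3, onto R^2 identified with C. *)
Definition pi2 (X : 'cV[R]_4) : R[i] := X 1 0 +i* X 2 0.

(* /\^2 R^4 is realised as the space of skew-symmetric 4 x 4 matrices. *)
Definition wedge (u v : 'cV[R]_4) : 'M[R]_4 := u *m v^T - v *m u^T.

Definition coplanar (s : seq 'cV[R]_4) : Prop :=
  exists A u v : 'cV[R]_4, \rank (row_mx u v) = 2%N /\
    forall X, X \in s -> exists a b : R, X = A + a *: u + b *: v.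

Definition sqnorm (z : R[i]) : R := complex.Re z ^+ 2 + complex.Im z ^+ 2.

Definition concircular (s : seq R[i]) : Prop :=
  (exists (c : R[i]) (r : R), 0 < r /\
     forall z, z \in s -> sqnorm (z - c) = r ^+ 2)
  \/
  (exists a v : R[i], v != 0 /\
     forall z, z \in s -> exists t : R, z = a + t%:C * v).

End Geometry.

Section Nets.
Variables (R : realType) (S : {pred Z2}).
Implicit Types (x g h : Z2 -> R[i]) (m : Z2 -> Z2 -> R).
Implicit Types (X Y N : Z2 -> 'cV[R]_4) (H : R).

(* A vanishing denominator would make the left-hand side of the cross-ratio
   equation 0 (as 0^-1 = 0), whereas its right-hand side is non-zero; hence
   adjacent values on an elementary quadrilateral are automatically distinct. *)
Definition cr_factorizing x m : Prop :=
  (forall i j, edge S i j -> m i j = m j i /\ m i j != 0) /\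
  (forall i j k l, quad S i j k l ->
     [/\ m i j = m l k, m i l = m j k &
         (x i - x j) / (x j - x k) * ((x k - x l) / (x l - x i)) =
         (m i l / m i j)%:C]).

Definition discrete_holomorphic x : Prop := exists m, cr_factorizing x m.

Definition circular_net X : Prop :=
  (forall i, i \in S -> in_iso3 (X i)) /\
  (forall i j k l, quad S i j k l ->
     coplanar [:: X i; X j; X k; X l] /\
     concircular [:: pi2 (X i); pi2 (X j); pi2 (X k); pi2 (X l)]).

Definition discrete_isothermic X : Prop :=
  circular_net X /\ discrete_holomorphic (fun i => pi2 (X i)).

(* Parallelism of vectors is linear dependence. *)
Definition edge_parallel X Y : Prop :=
  forall i j, edge S i j -> exists a b : R,
    (a, b) != (0, 0) /\ a *: (X i - X j) = b *: (Y i - Y j).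

Definition lightlike_gauss X N : Prop :=
  (forall i, i \in S -> in_cone (N i) /\ in_P (N i)) /\
  (forall i j, edge S i j -> exists c : R, N i - N j = c *: (X i - X j)).

Definition gauss_map N (i : Z2) : 'cV[R]_4 := N i - ptilde R.

Definition mixed_area X Y (i j k l : Z2) : 'M[R]_4 :=
  4^-1 *: (wedge (X i - X k) (Y j - Y l) - wedge (X j - X l) (Y i - Y k)).

Definition cmc H X N : Prop :=
  [/\ circular_net X, lightlike_gauss X N &
      forall i j k l, quad S i j k l ->
        mixed_area X N i j k l + H *: mixed_area X X i j k l = 0].

Definition weierstrass_gauss h g (i : Z2) : 'cV[R]_4 :=
  let phi := conjc (h i) + g i in
  - 2^-1 *: vec4 (1 + sqnorm phi) (2 * complex.Re phi)
                 (- (2 * complex.Im phi)) (-1 + sqnorm phi).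

Definition edge_mean x (i j : Z2) : R[i] := (x i + x j) / 2.

(* The division by m_ij dg_ij presupposes that dg_ij is non-zero; this is
   stated explicitly, as it matters on edges that bound no quadrilateral. *)
Definition weierstrass_data H Y h g : Prop :=
  [/\ cmc H Y (weierstrass_gauss h g),
      discrete_holomorphic h,
      (exists m, cr_factorizing g m /\
         forall i j, edge S i j ->
           g i - g j != 0 /\ h i - h j = H%:C / ((m i j)%:C * (g i - g j))) &
      forall i j, edge S i j ->
        Y i - Y j = H^-1 *: iso_pt
          (complex.Re ((conjc (edge_mean h i j) + edge_mean g i j) * (h i - h j)))
          (complex.Re (1 * (h i - h j)))
          (complex.Re (- 'i%C * (h i - h j)))].

End Nets.

(* Main.v *)
Require Import Defs.
From mathcomp Require Import all_boot all_order all_algebra.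
From mathcomp Require Import reals complex.
From mathcomp Require boolp.
From mathcomp Require Import ring lra.
Import Order.TTheory GRing.Theory Num.Theory.
Local Open Scope ring_scope.

(** The passage from Y to YP exchanges the roles of the two Weierstrass
    functions, because phi = conj h + g is unchanged when (h, g) is replaced by
    (conj g, conj h).  So YP has the same lightlike Gauss map N as Y
    ([wgauss_swap]), and three things have to be seen.

    Edges.  From d|phi|^2 = 2 Re(phi_ij conj(dphi_ij)), with phi_ij the edge
    mean, one gets dnu = - (Re(phi_ij conj(dphi_ij)), Re dphi, - Im dphi); as
    conj(dphi) = dh + conj(dg), adding dnu / H to dY cancels every dh and leaves
    - (1/H) Re((phi_ij, 1, -i) conj(dg)).  This is the Weierstrass formula for
    the data (conj g, conj h) and the curvature - H
    ([weierstrass_edge_parallel]).  It shows in particular that pi2(YP) is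
    - (1/H) conj g up to a constant.

    Duality.  Since dh = H / (m dg), the cross-ratio of h is (m_il / m_ij)^2
    divided by that of g, so h is factorized by the same m
    ([cr_factorizing_dual]).  Conjugating the relation gives
    d(conj h) = - H / ((- m) d(conj g)), so - m is the factorizing function of
    conj h that goes with the curvature - H.

    Curvature and circularity.  The mixed area is symmetric and bilinear, so
    A(YP,N) - H A(YP,YP) = - (A(Y,N) + H A(Y,Y)) = 0 ([mixed_area_parallel]).
    Edges of YP are multiples of those of Y, so its quadrilaterals remain planar
    ([coplanar_parallel]).  Their projections are similar to quadrilaterals of
    conj g, whose cross-ratio is real, and are therefore concircular
    ([cr_factorizing_concircular]).  Finally dN is a multiple of dYP because dYP
    cannot vanish, its projection being a non-zero multiple of conj(dg). *)

(** * Concircularity and real cross-ratios *)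

Section Concircularity.
Set Implicit Arguments.
Unset Strict Implicit.
Variable R : realType.
Local Open Scope complex_scope.
Implicit Types a b c d : R[i].

(** Twice the signed area of the triangle abc. *)
Definition orient a b c : R :=
  (complex.Re b - complex.Re a) * (complex.Im c - complex.Im a)
  - (complex.Im b - complex.Im a) * (complex.Re c - complex.Re a).

(** The imaginary part of the cross-ratio with its denominator cleared.  It
    equals, up to sign, the determinant of the rows (|z|^2, Re z, Im z, 1) for
    z = a, b, c, d, the classical concyclicity determinant; unlike the
    cross-ratio it remains meaningful when points coincide. *)
Definition cr_im a b c d : R :=
  complex.Im ((a - b) * (c - d) * conjc ((b - c) * (d - a))).

Lemma cr_im_eq0 a b c d (t : R) :
  (a - b) / (b - c) * ((c - d) / (d - a)) = t%:C -> cr_im a b c d = 0.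
Proof.
rewrite mulf_div /cr_im => cr.
have [->|nz] := eqVneq ((b - c) * (d - a)) 0.
  by rewrite conjc0 mulr0.
move/(canRL (divfK nz)): cr => ->.
by case: ((b - c) * (d - a)) => p q /=; ring.
Qed.

Lemma cr_im_swap a b c d : cr_im b a d c = cr_im a b c d.
Proof.
case: a b c d => a1 a2 [b1 b2] [c1 c2] [d1 d2].
by rewrite /cr_im /=; ring.
Qed.

(** The circumcentre solves a linear system whose determinant is a non-zero
    multiple of [orient a b c].  The power of d with respect to the circumcircle,
    multiplied by [orient a b c], is exactly [cr_im a b c d]. *)
Lemma circumcircle a b c : orient a b c != 0 ->
  exists (p : R[i]) (r : R), 0 < r /\
    forall d, cr_im a b c d = 0 -> sqnorm (d - p) = r ^+ 2.
Proof.
case: a b c => a1 a2 [b1 b2] [c1 c2]; rewrite /orient /= => D0.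
(* q is the circumcentre relative to a: 2 q.u = |u|^2 and 2 q.w = |w|^2. *)
pose u1 := b1 - a1; pose u2 := b2 - a2; pose w1 := c1 - a1; pose w2 := c2 - a2.
pose D := u1 * w2 - u2 * w1.
pose U := u1 ^+ 2 + u2 ^+ 2; pose W := w1 ^+ 2 + w2 ^+ 2.
pose q1 := (U * w2 - W * u2) / (2 * D); pose q2 := (u1 * W - w1 * U) / (2 * D).
have Dn0 : D != 0 by [].
have Q0 : 0 < q1 ^+ 2 + q2 ^+ 2.
  rewrite lt0r addr_ge0 ?sqr_ge0 // andbT.
  apply: contraNneq Dn0 => /eqP; rewrite paddr_eq0 ?sqr_ge0 // !sqrf_eq0.
  case/andP=> /eqP Eq1 /eqP Eq2.
  have : U = 2 * (q1 * u1 + q2 * u2).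
    by rewrite /q1 /q2 /D /U; field; exact: D0.
  rewrite Eq1 Eq2 !mul0r addr0 mulr0 => /eqP.
  rewrite paddr_eq0 ?sqr_ge0 // !sqrf_eq0 => /andP[/eqP u10 /eqP u20].
  by rewrite /D u10 u20; apply/eqP; ring.
exists ((a1 + q1) +i* (a2 + q2)), (Num.sqrt (q1 ^+ 2 + q2 ^+ 2)).
split; first by rewrite sqrtr_gt0.
case=> d1 d2; rewrite sqr_sqrtr ?ltW // /cr_im /sqnorm /= => cr0.
apply/eqP; rewrite -subr_eq0; apply/eqP.
apply: (mulfI Dn0); rewrite mulr0 -[RHS]cr0.
by rewrite /q1 /q2 /U /W /D /u1 /u2 /w1 /w2; field; exact: D0.
Qed.

Lemma orient0_collinear a b c : a != b -> orient a b c = 0 ->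
  exists t : R, c = a + t%:C * (b - a).
Proof.
case: a b c => a1 a2 [b1 b2] [c1 c2]; rewrite /orient /= => ab D0.
have U0 : (b1 - a1) ^+ 2 + (b2 - a2) ^+ 2 != 0.
  apply: contraNneq ab => /eqP; rewrite paddr_eq0 ?sqr_ge0 // !sqrf_eq0 !subr_eq0.
  by case/andP=> /eqP -> /eqP ->.
(* The foot of the perpendicular from c; its offset from c is proportional to [orient a b c]. *)
exists (((c1 - a1) * (b1 - a1) + (c2 - a2) * (b2 - a2))
        / ((b1 - a1) ^+ 2 + (b2 - a2) ^+ 2)).
apply/eqP; rewrite eq_complex /=; apply/andP; split; apply/eqP.
  rewrite -[LHS]subr0 -[X in _ - X](mulr0 (- (b2 - a2) / ((b1 - a1) ^+ 2 + (b2 - a2) ^+ 2))).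
  by rewrite -[in X in _ - X]D0; field; exact: U0.
rewrite -[LHS]subr0 -[X in _ - X](mulr0 ((b1 - a1) / ((b1 - a1) ^+ 2 + (b2 - a2) ^+ 2))).
by rewrite -[in X in _ - X]D0; field; exact: U0.
Qed.

(** If one of the triangles abc, abd is non-degenerate, its circumcircle contains
    the fourth point.  Otherwise both c and d lie on the line through a and b. *)
Lemma concircular_real_cr a b c d : a != b -> cr_im a b c d = 0 ->
  concircular [:: a; b; c; d].
Proof.
move=> ab cr0.
have on_abc : cr_im a b c a = 0 /\ cr_im a b c b = 0 /\ cr_im a b c c = 0.
  by move: a b c {ab cr0} => [? ?] [? ?] [? ?]; rewrite /cr_im /=; split; [|split]; ring.
have on_bad : cr_im b a d a = 0 /\ cr_im b a d b = 0 /\ cr_im b a d d = 0.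
  by move: a b d {ab cr0 on_abc} => [? ?] [? ?] [? ?]; rewrite /cr_im /=; split; [|split]; ring.
have [abc0|/circumcircle[p [r [r0 onC]]]] := eqVneq (orient a b c) 0; last first.
  left; exists p, r; split=> // z; rewrite !inE.
  by case/or4P=> /eqP ->; apply: onC; tauto.
have [bad0|/circumcircle[p [r [r0 onC]]]] := eqVneq (orient b a d) 0; last first.
  left; exists p, r; split=> // z; rewrite !inE.
  case/or4P=> /eqP ->; apply: onC; try tauto.
  by rewrite cr_im_swap cr0.
right; exists a, (b - a); split; first by rewrite subr_eq0 eq_sym.
have abd0 : orient a b d = 0.
  rewrite -[RHS]oppr0 -bad0.
  by move: a b d {ab cr0 on_abc abc0 on_bad bad0} => [? ?] [? ?] [? ?]; rewrite /orient /=; ring.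
move=> z; rewrite !inE; case/or4P=> /eqP ->.
- by exists 0; rewrite mul0r addr0.
- by exists 1; rewrite mul1r addrC subrK.
- exact: orient0_collinear.
- exact: orient0_collinear.
Qed.

End Concircularity.

(** * Operations on discrete holomorphic functions *)

Section DiscreteHolomorphic.
Set Implicit Arguments.
Unset Strict Implicit.
Variables (R : realType) (S : {pred Z2}).
Local Open Scope complex_scope.
Implicit Types (x y : Z2 -> R[i]) (m : Z2 -> Z2 -> R).

Lemma realC_neq0 (t : R) : t != 0 -> t%:C != 0.
Proof. by rewrite -(inj_eq (@complexI R)). Qed.

Lemma edgeC i j : edge S i j = edge S j i.
Proof.
rewrite /edge /adjacent andbCA (eq_sym i.1) (eq_sym i.2).
by rewrite (distrC i.1) (distrC i.2).
Qed.

Lemma quad_edges {i j k l} : quad S i j k l ->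
  [/\ edge S i j, edge S j k, edge S k l & edge S l i].
Proof.
case/andP=> /and4P[iS jS kS lS] /and3P[/eqP ej /eqP ek /eqP el].
rewrite /edge iS jS kS lS /adjacent ej ek el /= !eqxx /=.
have d1 (z : int) : `|z - (z + 1)| == 1 by rewrite opprD addNKr normrN1.
have d2 (z : int) : `|z + 1 - z| == 1 by rewrite addrC addKr normr1.
by rewrite !d1 !d2 !orbT.
Qed.

Lemma cr_factorizing_conj x m :
  cr_factorizing S x m -> cr_factorizing S (fun i => conjc (x i)) m.
Proof.
move=> [m_edge m_quad]; split=> // i j k l q.
have [mij mil cr] := m_quad _ _ _ _ q; split=> //.
by rewrite -[RHS]conjc_real -cr -!rmorphB -!conjc_inv -!rmorphM.
Qed.

Lemma cr_factorizing_scale x m (c : R) : c != 0 ->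
  cr_factorizing S x m -> cr_factorizing S x (fun i j => c * m i j).
Proof.
move=> c0 [m_edge m_quad]; split=> [i j e|i j k l q].
  by have [ms m0] := m_edge _ _ e; rewrite ms mulf_neq0 // -ms.
have [mij mil cr] := m_quad _ _ _ _ q; rewrite mij mil cr mil mij; split=> //.
by rewrite -mulf_div divff // mul1r.
Qed.

(** Along the quadrilateral the factors of k cancel, so the cross-ratio of y is
    (m_il / m_ij)^2 divided by that of x, which is m_il / m_ij. *)
Lemma cr_factorizing_dual x y m (k : R) : k != 0 -> cr_factorizing S x m ->
  (forall i j, edge S i j ->
    x i - x j != 0 /\ y i - y j = k%:C / ((m i j)%:C * (x i - x j))) ->
  cr_factorizing S y m.
Proof.
move=> k0 [m_edge m_quad] dy; split=> // i j a l q.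
have [mij mil cr] := m_quad _ _ _ _ q; split=> //.
have [eij eja eal eli] := quad_edges q.
have [[x1 ->] [x2 ->]] := (dy _ _ eij, dy _ _ eja).
have [[x3 ->] [x4 ->]] := (dy _ _ eal, dy _ _ eli).
have [_ m1] := m_edge _ _ eij; have [_ m2] := m_edge _ _ eja.
have [-> _] := m_edge _ _ eal; have [-> _] := m_edge _ _ eli.
rewrite -mij -mil in m2 *.
have -> : (m i l / m i j)%:C = (m i l / m i j)%:C ^+ 2 /
    ((x i - x j) / (x j - x a) * ((x a - x l) / (x l - x i))).
  by rewrite cr expr2 mulfK // realC_neq0 // mulf_neq0 ?invr_eq0.
rewrite rmorphM fmorphV /=.
by field; rewrite x1 x2 x3 x4 !realC_neq0.
Qed.

Lemma cr_factorizing_similar x y m (c : R[i]) : c != 0 ->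
  cr_factorizing S x m ->
  (forall i j, edge S i j -> y i - y j = c * (x i - x j)) ->
  cr_factorizing S y m.
Proof.
move=> c0 [m_edge m_quad] dy; split=> // i j a l q.
have [mij mil <-] := m_quad _ _ _ _ q; split=> //.
have [eij eja eal eli] := quad_edges q.
have cancel_c (u v : R[i]) : c * u / (c * v) = u / v.
  by rewrite -mulf_div divff // mul1r.
by rewrite !dy // !cancel_c.
Qed.

Lemma cr_factorizing_concircular x m i j k l : cr_factorizing S x m ->
  quad S i j k l -> x i - x j != 0 -> concircular [:: x i; x j; x k; x l].
Proof.
move=> [_ m_quad] q xij; have [_ _ cr] := m_quad _ _ _ _ q.
by apply: concircular_real_cr (cr_im_eq0 cr); rewrite -subr_eq0.
Qed.

End DiscreteHolomorphic.

(** * Parallel nets in isotropic space *)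

Section Minkowski.
Set Implicit Arguments.
Unset Strict Implicit.
Variable R : realType.
Local Open Scope complex_scope.
Implicit Types (X N : Z2 -> 'cV[R]_4).

Lemma cV4P (u v : 'cV[R]_4) :
  u 0 0 = v 0 0 -> u 1 0 = v 1 0 -> u 2 0 = v 2 0 -> u 3 0 = v 3 0 -> u = v.
Proof.
move=> e0 e1 e2 e3; apply/colP=> -[[|[|[|[|//]]]] lt4].
- by rewrite (_ : Ordinal _ = 0); last exact: val_inj.
- by rewrite (_ : Ordinal _ = 1); last exact: val_inj.
- by rewrite (_ : Ordinal _ = 2); last exact: val_inj.
- by rewrite (_ : Ordinal _ = 3); last exact: val_inj.
Qed.

(** The direction plane of the first quadrilateral contains the edges of the
    second, even when the first one degenerates to a line or a point. *)
Lemma coplanar_parallel (A B C D A' B' C' D' : 'cV[R]_4) :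
  coplanar [:: A; B; C; D] ->
  (exists t : R, A' - B' = t *: (A - B)) ->
  (exists t : R, B' - C' = t *: (B - C)) ->
  (exists t : R, C' - D' = t *: (C - D)) ->
  coplanar [:: A'; B'; C'; D'].
Proof.
move=> [O [u [v [rk inP]]]] [t1 /eqP e1] [t2 /eqP e2] [t3 /eqP e3].
exists A', u, v; split=> //.
have [|p1 [q1 eA]] := inP A _; rewrite ?inE ?eqxx ?orbT //.
have [|p2 [q2 eB]] := inP B _; rewrite ?inE ?eqxx ?orbT //.
have [|p3 [q3 eC]] := inP C _; rewrite ?inE ?eqxx ?orbT //.
have [|p4 [q4 eD]] := inP D _; rewrite ?inE ?eqxx ?orbT //.
have sub (P Q : 'cV[R]_4) p q p' q' : P = O + p *: u + q *: v ->
    Q = O + p' *: u + q' *: v -> P - Q = (p - p') *: u + (q - q') *: v.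
  by move=> -> ->; apply/colP=> i; rewrite !mxE; ring.
rewrite (sub _ _ _ _ _ _ eA eB) in e1; rewrite (sub _ _ _ _ _ _ eB eC) in e2.
rewrite (sub _ _ _ _ _ _ eC eD) in e3.
have {e1}eB' : B' = A' - t1 *: ((p1 - p2) *: u + (q1 - q2) *: v).
  by rewrite -(eqP e1) opprB addrC subrK.
have {e2}eC' : C' = B' - t2 *: ((p2 - p3) *: u + (q2 - q3) *: v).
  by rewrite -(eqP e2) opprB addrC subrK.
have {e3}eD' : D' = C' - t3 *: ((p3 - p4) *: u + (q3 - q4) *: v).
  by rewrite -(eqP e3) opprB addrC subrK.
move=> X; rewrite !inE; case/or4P=> /eqP ->.
- by exists 0, 0; rewrite !scale0r !addr0.
- exists (- t1 * (p1 - p2)), (- t1 * (q1 - q2)).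
  by rewrite eB'; apply/colP=> i; rewrite !mxE; ring.
- exists (- t1 * (p1 - p2) - t2 * (p2 - p3)), (- t1 * (q1 - q2) - t2 * (q2 - q3)).
  by rewrite eC' eB'; apply/colP=> i; rewrite !mxE; ring.
- exists (- t1 * (p1 - p2) - t2 * (p2 - p3) - t3 * (p3 - p4)).
  exists (- t1 * (q1 - q2) - t2 * (q2 - q3) - t3 * (q3 - q4)).
  by rewrite eD' eC' eB'; apply/colP=> i; rewrite !mxE; ring.
Qed.

(** By bilinearity and symmetry A(XP,N) = A(X,N) + A(N,N)/H and
    A(XP,XP) = A(X,X) + (2/H) A(X,N) + A(N,N)/H^2, so the terms A(N,N) cancel. *)
Lemma mixed_area_parallel H X N (q : 'cV[R]_4) i j k l : H != 0 ->
  let XP := fun n => X n + H^-1 *: (N n - q) in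
  mixed_area XP N i j k l + (- H) *: mixed_area XP XP i j k l
  = - (mixed_area X N i j k l + H *: mixed_area X X i j k l).
Proof.
move=> H0 /=; apply/matrixP=> a b; rewrite !mxE !big_ord1 !mxE.
by field; exact: H0.
Qed.

Lemma wgauss_swap (h g : Z2 -> R[i]) :
  weierstrass_gauss (fun i => conjc (g i)) (fun i => conjc (h i))
  =1 weierstrass_gauss h g.
Proof. by move=> i; rewrite /weierstrass_gauss conjcK (addrC (g i)). Qed.

Lemma pi2B (U V : 'cV[R]_4) : pi2 U - pi2 V = pi2 (U - V).
Proof. by apply/eqP; rewrite eq_complex /= !mxE !eqxx. Qed.

Lemma pi2_iso (l : R) (w : R[i]) (k : R) :
  pi2 (k *: iso_pt l (complex.Re (1 * w)) (complex.Re (- 'i%C * w))) = k%:C * w.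
Proof.
by case: w => a b; apply/eqP; rewrite eq_complex /= !mxE /=; apply/andP; split; apply/eqP; ring.
Qed.

Lemma iso3_gauss_map N i : in_P (N i) -> in_iso3 (gauss_map N i).
Proof. by rewrite /in_iso3 /in_P /mink !mxE /= => NP; lra. Qed.

Lemma in_iso3D (U V : 'cV[R]_4) (k : R) :
  in_iso3 U -> in_iso3 V -> in_iso3 (U + k *: V).
Proof.
rewrite /in_iso3 => U0 V0; transitivity (mink U (pvec R) + k * mink V (pvec R)).
  by rewrite /mink !mxE; ring.
by rewrite U0 V0 mulr0 addr0.
Qed.

(** With phi = conj h + g and conj(dphi) = dh + conj(dg), the Gauss map contributes
    - Re(phi_ij conj(dphi)) / H to the isotropic coordinate, and similarly in the
    plane; all terms in dh cancel against those of dY. *)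
Lemma weierstrass_edge_parallel H (h g : Z2 -> R[i]) i j : H != 0 ->
  H^-1 *: iso_pt
    (complex.Re ((conjc (edge_mean h i j) + edge_mean g i j) * (h i - h j)))
    (complex.Re (1 * (h i - h j))) (complex.Re (- 'i%C * (h i - h j)))
  + H^-1 *: (weierstrass_gauss h g i - weierstrass_gauss h g j)
  = (- H)^-1 *: iso_pt
    (complex.Re ((conjc (edge_mean (fun n => conjc (g n)) i j)
                  + edge_mean (fun n => conjc (h n)) i j)
                 * (conjc (g i) - conjc (g j))))
    (complex.Re (1 * (conjc (g i) - conjc (g j))))
    (complex.Re (- 'i%C * (conjc (g i) - conjc (g j)))).
Proof.
move=> H0; rewrite /weierstrass_gauss /edge_mean /sqnorm.
have half (z : R[i]) : z / 2 = (complex.Re z / 2) +i* (complex.Im z / 2).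
  apply/eqP; rewrite (can2_eq (divfK _) (mulfK _)) ?pnatr_eq0 //.
  by case: z => a b; rewrite eq_complex /=; apply/andP; split; apply/eqP; field.
rewrite !half.
move: (h i) (h j) (g i) (g j) => [a1 a2] [b1 b2] [c1 c2] [d1 d2].
by apply: cV4P; rewrite !mxE /=; field; exact: H0.
Qed.

End Minkowski.

Theorem theorem3p9 (R : realType) (S : {pred Z2}) (H : R)
    (Y : Z2 -> 'cV[R]_4) (h g : Z2 -> R[i])
    (simply_connected_S : simply_connected S)
    (H_neq0 : H != 0)
    (isothermic_Y : discrete_isothermic S Y)
    (data_Y : weierstrass_data S H Y h g) :
  let nu := gauss_map (weierstrass_gauss h g) in
  let YP := fun i : Z2 => Y i + H^-1 *: nu i in
  let hP := fun i : Z2 => conjc (g i) in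
  let gP := fun i : Z2 => conjc (h i) in
  edge_parallel S Y YP /\ weierstrass_data S (- H) YP hP gP.
Proof.
set N := weierstrass_gauss h g; move=> nu YP hP gP.
rewrite /weierstrass_data -/N in data_Y.
have [[[Y_iso Y_circ] [N_quadric N_par] Y_area] _ [m [m_fact dh]] dY] := data_Y.
have dYP i j : YP i - YP j = Y i - Y j + H^-1 *: (N i - N j).
  by rewrite /YP /nu /gauss_map -/N; apply/colP=> n; rewrite !mxE; ring.
have YP_scale i j : edge S i j ->
    exists c : R, N i - N j = c *: (Y i - Y j) /\
                  YP i - YP j = (1 + H^-1 * c) *: (Y i - Y j).
  move=> e; have [c Nc] := N_par _ _ e; exists c; split=> //.
  by rewrite dYP Nc scalerA scalerDl scale1r.
have YP_weier i j : edge S i j -> YP i - YP j = (- H)^-1 *: iso_pt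
    (complex.Re ((conjc (edge_mean hP i j) + edge_mean gP i j) * (hP i - hP j)))
    (complex.Re (1 * (hP i - hP j))) (complex.Re (- 'i%C * (hP i - hP j))).
  by move=> e; rewrite dYP dY // weierstrass_edge_parallel.
have YP_pi2 i j : edge S i j ->
    pi2 (YP i) - pi2 (YP j) = (- H)^-1%:C%C * (hP i - hP j).
  by move=> e; rewrite pi2B YP_weier // pi2_iso.
have k_neq0 : (- H)^-1%:C%C != 0.
  by apply: realC_neq0; rewrite invr_eq0 oppr_eq0.
have hP_fact : cr_factorizing S hP m := cr_factorizing_conj m_fact.
have dhP_neq0 i j : edge S i j -> hP i - hP j != 0.
  by move=> /dh[dg _]; rewrite /hP -rmorphB conjc_eq0.
have piYP_fact := cr_factorizing_similar k_neq0 hP_fact YP_pi2.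
have dpiYP_neq0 i j : edge S i j -> pi2 (YP i) - pi2 (YP j) != 0.
  by move=> e; rewrite YP_pi2 // mulf_neq0 // dhP_neq0.
have NP_eq : weierstrass_gauss hP gP = N.
  by apply: boolp.funext => i; exact: wgauss_swap.
split.
  move=> i j /YP_scale[c [_ ->]]; exists (1 + H^-1 * c), 1; split.
    by rewrite xpair_eqE oner_eq0 andbF.
  by rewrite scale1r.
split.
- rewrite /cmc NP_eq; split.
  + split=> [i iS|i j k l q].
      apply: in_iso3D; first exact: Y_iso.
      by apply: iso3_gauss_map; have [] := N_quadric i iS.
    have [eij ejk ekl _] := quad_edges q.
    split; last by apply: cr_factorizing_concircular piYP_fact q (dpiYP_neq0 _ _ eij).
    have [cop _] := Y_circ _ _ _ _ q.
    by apply: coplanar_parallel cop _ _ _;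
      [have [c [_]] := YP_scale _ _ eij | have [c [_]] := YP_scale _ _ ejk
      |have [c [_]] := YP_scale _ _ ekl]; exists (1 + H^-1 * c).
  + split=> // i j e; have [c [Nc YPc]] := YP_scale _ _ e.
    (* At c = - H the edge of YP would collapse, but its projection is not 0. *)
    have c0 : 1 + H^-1 * c != 0.
      apply: contraNneq (dpiYP_neq0 _ _ e) => c0.
      by rewrite pi2B YPc c0 scale0r /pi2 !mxE.
    exists (c / (1 + H^-1 * c)).
    by rewrite Nc YPc scalerA divfK.
  + move=> i j k l q.
    by rewrite mixed_area_parallel // Y_area // oppr0.
- by exists m.
(* The sign of the curvature is absorbed in the factorizing function. *)
- exists (fun i j => -1 * m i j); split.
    apply: cr_factorizing_scale; first by rewrite oppr_eq0 oner_eq0.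
    apply: cr_factorizing_conj.
    exact: cr_factorizing_dual H_neq0 m_fact dh.
  move=> i j e; have [dg0 dh_ij] := dh i j e.
  have [_ m0] := (m_fact.1 i j e).
  have mC0 := realC_neq0 m0.
  have HC0 := realC_neq0 H_neq0.
  have dhP : gP i - gP j = H%:C%C / ((m i j)%:C%C * (hP i - hP j)).
    rewrite /gP /hP -!rmorphB dh_ij -[in RHS](conjc_real (m i j)) -[in RHS](conjc_real H).
    by rewrite -rmorphM -conjc_inv -rmorphM.
  have dhP0 := dhP_neq0 i j e.
  split; first by rewrite dhP !mulf_neq0 ?invr_eq0 ?mulf_neq0.
  rewrite dhP mulN1r !rmorphN /=; field.
  by rewrite mC0 HC0 dhP0.
- exact: YP_weier.
Qed.
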